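(* For a solution $(q,u,p,\lambda)$ of the augmented adjoint DAE system $$\dot q^i=f^i(q,u),\quad \dot p_j=-p_i\frac{\partial f^i}{\partial q^j}-\lambda_A\frac{\partial\phi^A}{\partial q^j}-\frac{\partial L}{\partial q^j},\quad 0=\phi^A(q,u),\quad 0=p_i\frac{\partial f^i}{\partial u^a}+\lambda_A\frac{\partial\phi^A}{\partial u^a}+\frac{\partial L}{\partial u^a},$$ and a solution $(q,u,\delta q,\delta u)$ of the variational equations $$\dot q=f(q,u),\quad 0=\phi(q,u),\quad \frac{d}{dt}\delta q=D_qf(q,u)\delta q+D_uf(q,u)\delta u,\quad 0=D_q\phi(q,u)\delta q+D_u\phi(q,u)\delta u,$$ covering the same solution $(q,u)$ of the base DAE $\dot q=f(q,u)$, $0=\phi(q,u)$, $$\frac{d}{dt}\langle p,\delta q\rangle=-\langle\nabla_qL,\delta q\rangle-\langle\nabla_uL,\delta u\rangle.$$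
   Context: All manifolds and maps are smooth; the equations are written in local coordinates. $M_d$, $M_a$ are manifolds with local coordinates $q=(q^i)$, $u=(u^a)$; $\Phi\to M_d\times M_a$ is a vector bundle with dual $\Phi^*$; $\overline{TM}_d$ and $\overline{T^*M}_d$ are the pullbacks of $TM_d$ and $T^*M_d$ to $M_d\times M_a$ by the projection $M_d\times M_a\to M_d$. The base DAE is specified by sections $f\in\Gamma(\overline{TM}_d)$, $\phi\in\Gamma(\Phi)$ (components $\phi^A$ in a local trivialization), and it is assumed that $D\phi$ has constant rank. $L:M_d\times M_a\to\mathbb R$ is a function. $(q,u,p,\lambda)$ are coordinates on the Whitney sum $\overline{T^*M}_d\oplus\Phi^*$; the augmented adjoint DAE system is the presymplectic Hamiltonian system $i_{X_{H_L}}\Omega_0=dH_L$ with $\Omega_0=dq^i\wedge dp_i$ and $H_L=\langle p,f(q,u)\rangle+\langle\lambda,\phi(q,u)\rangle+L(q,u)$. $\langle\nabla_qL,\delta q\rangle=\frac{\partial L}{\partial q^i}\delta q^i$ and $\langle\nabla_uL,\delta u\rangle=\frac{\partial L}{\partial u^a}\delta u^a$. *)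

(* Defs.v *)
From HB Require Import structures.
From mathcomp Require Import all_boot all_order all_algebra.
From mathcomp Require Import all_classical all_reals all_analysis.

Set Implicit Arguments.
Unset Strict Implicit.
Unset Printing Implicit Defensive.

Import Order.TTheory GRing.Theory Num.Theory numFieldNormedType.Exports.

Local Open Scope classical_set_scope.
Local Open Scope ring_scope.

(* C^k on [A]; used with [A] open and [V], [W] finite-dimensional, where
   "x |-> 'd f x is C^k" can be tested on each vector [v] separately. *)
Fixpoint Ck (R : realType) (V W : normedModType R) (k : nat) (A : set V)
    (f : V -> W) : Prop :=
  if k is k'.+1 then
    (forall x, A x -> differentiable f x) /\
    (forall v, Ck k' A (fun x => 'd f x v : W))
  else forall x, A x -> {for x, continuous f}.

Definition smooth (R : realType) (V W : normedModType R) (A : set V)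
    (f : V -> W) : Prop := forall k, Ck k A f.

(* [to_coord] and [of_coord] are total functions, meaningful only on [source]
   and [target] respectively. *)
Record chart (R : realType) (n : nat) (M : topologicalType) := Chart {
  source : set M;
  target : set 'rV[R]_n;
  to_coord : M -> 'rV[R]_n;
  of_coord : 'rV[R]_n -> M;
  open_source : open source;
  open_target : open target;
  to_coord_target : forall x, source x -> target (to_coord x);
  of_coord_source : forall z, target z -> source (of_coord z);
  to_coordK : forall x, source x -> of_coord (to_coord x) = x;
  of_coordK : forall z, target z -> to_coord (of_coord z) = z;
  to_coord_continuous : forall x, source x -> {for x, continuous to_coord};
  of_coord_continuous : forall z, target z -> {for z, continuous of_coord}
}.

Definition transition (R : realType) (n : nat) (M : topologicalType)
    (a b : chart R n M) : 'rV[R]_n -> 'rV[R]_n :=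
  fun z => to_coord b (of_coord a z).

Record manifold (R : realType) (n : nat) := Manifold {
  space :> topologicalType;
  manifold_hausdorff : hausdorff_space space;
  manifold_second_countable : @second_countable space;
  chart_index : Type;
  charts : chart_index -> chart R n space;
  chart_at : space -> chart_index;
  chart_at_source : forall x, source (charts (chart_at x)) x;
  transition_smooth : forall a b,
    smooth [set z | target (charts a) z /\
                    source (charts b) (of_coord (charts a) z)]
           (transition (charts a) (charts b))
}.

(* The tangent and cotangent spaces at [x], as families of components in the
   charts around [x] subject to the usual transformation laws
     v'^j = (d x'^j / d x^i) v^i   and   p_i = p'_j (d x'^j / d x^i).
   The components in a chart not containing [x] are irrelevant. *)
Record tangent (R : realType) (n : nat) (M : manifold R n) (x : M) := Tangent {
  tcomp : chart_index M -> 'rV[R]_n;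
  tangent_law : forall a b, source (charts a) x -> source (charts b) x ->
    tcomp b = 'd (transition (charts a) (charts b)) (to_coord (charts a) x) (tcomp a)
}.

Record cotangent (R : realType) (n : nat) (M : manifold R n) (x : M) :=
  Cotangent {
  ccomp : chart_index M -> 'rV[R]_n;
  cotangent_law : forall a b i, source (charts a) x -> source (charts b) x ->
    ccomp a 0 i =
    \sum_j ccomp b 0 j *
      ('D_('e_i) (transition (charts a) (charts b)) (to_coord (charts a) x)) 0 j
}.

(* By the transformation laws, any chart around [x] gives the same value. *)
Definition pairing (R : realType) (n : nat) (M : manifold R n) (x : M)
    (p : cotangent x) (v : tangent x) : R :=
  \sum_i ccomp p (chart_at x) 0 i * tcomp v (chart_at x) 0 i.

Definition smooth_curve (R : realType) (d : nat) (M : manifold R d) (I : set R)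
    (x : R -> M) : Prop :=
  (forall t, I t -> {for t, continuous x}) /\
  (forall a, smooth [set t | I t /\ source (charts a) (x t)]
                    (fun t => to_coord (charts a) (x t))).

Definition smooth_vector (R : realType) (d : nat) (M : manifold R d) (I : set R)
    (x : R -> M) (v : forall t, tangent (x t)) : Prop :=
  forall a, smooth [set t | I t /\ source (charts a) (x t)]
                   (fun t => tcomp (v t) a).

Definition smooth_covector (R : realType) (d : nat) (M : manifold R d) (I : set R)
    (x : R -> M) (p : forall t, cotangent (x t)) : Prop :=
  forall a, smooth [set t | I t /\ source (charts a) (x t)]
                   (fun t => ccomp (p t) a).

(* Coordinates, in the product of the charts [a] and [b], of the points of
   [A]. *)
Definition coord_dom (R : realType) (n m : nat)
    (Md : manifold R n) (Ma : manifold R m) (A : set (Md * Ma))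
    (a : chart_index Md) (b : chart_index Ma) : set ('rV[R]_n * 'rV[R]_m) :=
  [set z | [/\ target (charts a) z.1, target (charts b) z.2 &
               A (of_coord (charts a) z.1, of_coord (charts b) z.2)]].

(* A rank [k] vector bundle over [Md * Ma]: on [triv_dom c], [frame c] is a
   basis of each fibre and [coords c] gives the components in this basis. *)
Record vector_bundle (R : realType) (n m : nat)
    (Md : manifold R n) (Ma : manifold R m) (k : nat) := VectorBundle {
  fiber :> Md -> Ma -> lmodType R;
  triv_index : Type;
  triv_dom : triv_index -> set (Md * Ma);
  frame : triv_index -> forall x y, 'I_k -> fiber x y;
  coords : triv_index -> forall x y, {linear fiber x y -> 'rV[R]_k};
  triv_dom_open : forall c, open (triv_dom c);
  triv_dom_cover : forall xy, exists c, triv_dom c xy;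
  coords_frame : forall c x y A, triv_dom c (x, y) ->
    coords c x y (frame c x y A) = 'e_A;
  frame_coords : forall c x y (v : fiber x y), triv_dom c (x, y) ->
    v = \sum_A coords c x y v 0 A *: frame c x y A;
  triv_smooth : forall c d A a b,
    smooth (coord_dom (triv_dom c `&` triv_dom d) a b)
           (fun z => let x := of_coord (charts a) z.1 in
                     let y := of_coord (charts b) z.2 in
                     coords d x y (frame c x y A))
}.

Section LocalRepresentatives.
Context {R : realType} {n m k : nat}.
Context {Md : manifold R n} {Ma : manifold R m} {Phi : vector_bundle Md Ma k}.

Implicit Types (a : chart_index Md) (b : chart_index Ma) (c : triv_index Phi).

(* [f] is a section of the pullback of the tangent bundle of [Md]. *)
Definition loc_f (f : forall (x : Md) (y : Ma), tangent x) a b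
    (z : 'rV[R]_n) (w : 'rV[R]_m) : 'rV[R]_n :=
  tcomp (f (of_coord (charts a) z) (of_coord (charts b) w)) a.

Definition loc_phi (phi : forall x y, Phi x y) c a b
    (z : 'rV[R]_n) (w : 'rV[R]_m) : 'rV[R]_k :=
  coords c _ _ (phi (of_coord (charts a) z) (of_coord (charts b) w)).

Definition loc_L (L : Md -> Ma -> R) a b
    (z : 'rV[R]_n) (w : 'rV[R]_m) : R :=
  L (of_coord (charts a) z) (of_coord (charts b) w).

Definition smooth_f (f : forall (x : Md) (y : Ma), tangent x) : Prop :=
  forall a b, smooth (coord_dom setT a b) (fun z => loc_f f a b z.1 z.2).

Definition smooth_phi (phi : forall x y, Phi x y) : Prop :=
  forall c a b, smooth (coord_dom (triv_dom c) a b)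
                       (fun z => loc_phi phi c a b z.1 z.2).

Definition smooth_L (L : Md -> Ma -> R) : Prop :=
  forall a b, smooth (coord_dom setT a b) (fun z => loc_L L a b z.1 z.2).

End LocalRepresentatives.

Section PartialDerivatives.
Context {R : realType} {n m : nat} {V : normedModType R}.

Definition Dq (F : 'rV[R]_n -> 'rV[R]_m -> V) z w (v : 'rV[R]_n) : V :=
  'd (fun z' => F z' w) z v.

Definition Du (F : 'rV[R]_n -> 'rV[R]_m -> V) z w (v : 'rV[R]_m) : V :=
  'd (fun w' => F z w') w v.

Definition pdq (j : 'I_n) (F : 'rV[R]_n -> 'rV[R]_m -> V) z w : V :=
  'D_('e_j) (fun z' => F z' w) z.

Definition pdu (j : 'I_m) (F : 'rV[R]_n -> 'rV[R]_m -> V) z w : V :=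
  'D_('e_j) (fun w' => F z w') w.

End PartialDerivatives.

Definition entry (R : realType) (n m k : nat)
    (F : 'rV[R]_n -> 'rV[R]_m -> 'rV[R]_k) (i : 'I_k) :
    'rV[R]_n -> 'rV[R]_m -> R :=
  fun z w => F z w 0 i.

Definition jacobian2 (R : realType) (n m k : nat)
    (F : 'rV[R]_n -> 'rV[R]_m -> 'rV[R]_k) z w : 'M[R]_(k, n + m) :=
  row_mx (\matrix_(i, j) pdq j (entry F i) z w)
         (\matrix_(i, j) pdu j (entry F i) z w).

Section Systems.
Context {R : realType} {n m k : nat}.
Context {Md : manifold R n} {Ma : manifold R m} {Phi : vector_bundle Md Ma k}.

Implicit Types (a : chart_index Md) (b : chart_index Ma) (c : triv_index Phi).

(* For a section of a bundle, D phi does not depend on the trivialization only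
   at the zeros of phi, so the rank is required to be constant there. *)
Definition constant_rank (phi : forall x y, Phi x y) : Prop :=
  exists r : nat, forall c a b z w,
    coord_dom (triv_dom c) a b (z, w) ->
    loc_phi phi c a b z w = 0 ->
    \rank (jacobian2 (loc_phi phi c a b) z w) = r.

Context (f : forall (x : Md) (y : Ma), tangent x)
          (phi : forall x y, Phi x y) (L : Md -> Ma -> R).

(* <nabla_q L, v> and <nabla_u L, v>; the values do not depend on the charts. *)
Definition grad_q (x : Md) (y : Ma) (v : tangent x) : R :=
  let a := chart_at x in let b := chart_at y in
  \sum_i pdq i (loc_L L a b) (to_coord (charts a) x) (to_coord (charts b) y)
         * tcomp v a 0 i.

Definition grad_u (x : Md) (y : Ma) (v : tangent y) : R :=
  let a := chart_at x in let b := chart_at y in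
  \sum_i pdu i (loc_L L a b) (to_coord (charts a) x) (to_coord (charts b) y)
         * tcomp v b 0 i.

Context (I : set R) (q : R -> Md) (u : R -> Ma).

Definition smooth_multiplier (lambda : forall t, {scalar Phi (q t) (u t)}) :
    Prop :=
  forall c A, smooth [set t | I t /\ triv_dom c (q t, u t)]
                     (fun t => lambda t (frame c (q t) (u t) A) : R).

Record base_solution : Prop := BaseSolution {
  base_q_smooth : smooth_curve I q;
  base_u_smooth : smooth_curve I u;
  base_ode : forall t a, I t -> source (charts a) (q t) ->
    is_derive t 1 (fun s => to_coord (charts a) (q s))
              (tcomp (f (q t) (u t)) a);
  base_constraint : forall t, I t -> phi (q t) (u t) = 0
}.

Record adjoint_solution (p : forall t, cotangent (q t))
    (lambda : forall t, {scalar Phi (q t) (u t)}) : Prop := AdjointSolution {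
  adjoint_base : base_solution;
  adjoint_p_smooth : smooth_covector I p;
  adjoint_lambda_smooth : smooth_multiplier lambda;
  adjoint_ode : forall t a b c j, I t ->
    source (charts a) (q t) -> source (charts b) (u t) ->
    triv_dom c (q t, u t) ->
    let z := to_coord (charts a) (q t) in let w := to_coord (charts b) (u t) in
    is_derive t 1 (fun s => ccomp (p s) a 0 j : R)
      (- (\sum_i ccomp (p t) a 0 i * pdq j (entry (loc_f f a b) i) z w)
       - (\sum_A lambda t (frame c (q t) (u t) A)
                 * pdq j (entry (loc_phi phi c a b) A) z w)
       - pdq j (loc_L L a b) z w);
  adjoint_constraint : forall t a b c j, I t ->
    source (charts a) (q t) -> source (charts b) (u t) ->
    triv_dom c (q t, u t) ->
    let z := to_coord (charts a) (q t) in let w := to_coord (charts b) (u t) in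
    0 = \sum_i ccomp (p t) a 0 i * pdu j (entry (loc_f f a b) i) z w
        + \sum_A lambda t (frame c (q t) (u t) A)
                 * pdu j (entry (loc_phi phi c a b) A) z w
        + pdu j (loc_L L a b) z w
}.

Record variational_solution (dq : forall t, tangent (q t))
    (du : forall t, tangent (u t)) : Prop := VariationalSolution {
  variational_base : base_solution;
  variational_dq_smooth : smooth_vector I dq;
  variational_du_smooth : smooth_vector I du;
  variational_ode : forall t a b, I t ->
    source (charts a) (q t) -> source (charts b) (u t) ->
    let z := to_coord (charts a) (q t) in let w := to_coord (charts b) (u t) in
    is_derive t 1 (fun s => tcomp (dq s) a)
      (Dq (loc_f f a b) z w (tcomp (dq t) a)
       + Du (loc_f f a b) z w (tcomp (du t) b));
  variational_constraint : forall t a b c, I t ->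
    source (charts a) (q t) -> source (charts b) (u t) ->
    triv_dom c (q t, u t) ->
    let z := to_coord (charts a) (q t) in let w := to_coord (charts b) (u t) in
    0 = Dq (loc_phi phi c a b) z w (tcomp (dq t) a)
        + Du (loc_phi phi c a b) z w (tcomp (du t) b)
}.

End Systems.

(* Main.v *)
(* Near [t], compute <p, dq> in a fixed chart around q(t); this is licit because
   the pairing is chart independent.  By the product rule and the two systems,
   the terms in D_q f cancel.  The constraint on p turns p . D_u f . du into
   - lambda . D_u phi . du - D_u L . du, and the linearized constraint
   D_q phi . dq + D_u phi . du = 0 cancels the terms in lambda, which leaves
   - D_q L . dq - D_u L . du. *)
Require Import Defs.
From mathcomp Require Import all_boot all_order all_algebra.
From mathcomp Require Import all_classical all_reals all_analysis.
From mathcomp Require Import ring.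

Import Order.TTheory GRing.Theory Num.Theory numFieldNormedType.Exports.

Local Open Scope classical_set_scope.
Local Open Scope ring_scope.

Lemma linear_rV_sum (R : pzRingType) (n : nat) (W : lmodType R)
    (g : {linear 'rV[R]_n -> W}) (v : 'rV[R]_n) :
  g v = \sum_j v 0 j *: g 'e_j.
Proof.
rewrite {1}[v]row_sum_delta linear_sum.
by apply: eq_bigr => j _; rewrite linearZ.
Qed.

Lemma diff_rV_entry (R : realType) (n k : nat) (g : 'rV[R]_n -> 'rV[R]_k)
    (z v : 'rV[R]_n) (i : 'I_k) : differentiable g z ->
  ('d g z v) 0 i = \sum_j v 0 j * 'D_('e_j) (fun z' => g z' 0 i) z.
Proof.
move=> dg; rewrite linear_rV_sum summxE; apply: eq_bigr => j _.
rewrite mxE -deriveE //; congr (_ * _).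
by rewrite derive_mx ?mxE //; exact: diff_derivable.
Qed.

Lemma is_derive_rV_entry (R : realType) (V : normedModType R) (n : nat)
    (g : V -> 'rV[R]_n) (x v : V) (dg : 'rV[R]_n) (i : 'I_n) :
  is_derive x v g dg -> is_derive x v (fun y => g y 0 i) (dg 0 i).
Proof.
move=> [dg1 dg2]; split; first by have /derivable_mxP := dg1; apply.
by rewrite -dg2 derive_mx // mxE.
Qed.

Lemma smooth_differentiable (R : realType) (V W : normedModType R) (A : set V)
    (g : V -> W) (x : V) : smooth A g -> A x -> differentiable g x.
Proof. by move=> /(_ 1%N)[+ _]; exact. Qed.

(** Vectors transform by the Jacobian of the transition map and covectors by its transpose, so
    exchanging the two sums moves the Jacobian from [v] onto [p]. *)
Lemma pairing_chart (R : realType) (n : nat) (M : manifold R n) (x : M)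
    (p : cotangent x) (v : tangent x) (a : chart_index M) :
  source (charts a) x -> pairing p v = \sum_i ccomp p a 0 i * tcomp v a 0 i.
Proof.
move=> ax; have bx := chart_at_source x; set b := chart_at x in bx *.
(* The tangent law uses the differential, the cotangent law directional derivatives;
   differentiability identifies the two. *)
have dT : differentiable (transition (charts a) (charts b))
    (to_coord (charts a) x).
  apply: smooth_differentiable (transition_smooth a b) _.
  by split; [exact: to_coord_target | rewrite to_coordK].
rewrite /pairing -/b.
under eq_bigr do rewrite (tangent_law v ax bx) linear_rV_sum summxE mulr_sumr.
rewrite exchange_big; apply: eq_bigr => i _.
rewrite (cotangent_law p i ax bx) mulr_suml; apply: eq_bigr => j _.
by rewrite mxE deriveE // -mulrA; congr (_ * _); rewrite mulrC.
Qed.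

(** Bridge between the differentials of the variational equations and the partial derivatives of the
    adjoint system. Joint differentiability restricts to the slice through [w]. *)
Lemma Dq_entry (R : realType) (n m k : nat)
    (F : 'rV[R]_n -> 'rV[R]_m -> 'rV[R]_k) z w v i :
  differentiable (fun x => F x.1 x.2) (z, w) ->
  Dq F z w v 0 i = \sum_j v 0 j * pdq j (entry F i) z w.
Proof.
move=> dF; apply: diff_rV_entry.
exact: (@differentiable_comp _ _ _ _ (fun z' => (z', w)) (fun x => F x.1 x.2)).
Qed.

Lemma Du_entry (R : realType) (n m k : nat)
    (F : 'rV[R]_n -> 'rV[R]_m -> 'rV[R]_k) z w v i :
  differentiable (fun x => F x.1 x.2) (z, w) ->
  Du F z w v 0 i = \sum_j v 0 j * pdu j (entry F i) z w.
Proof.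
move=> dF; apply: diff_rV_entry.
exact: (@differentiable_comp _ _ _ _ (fun w' => (z, w')) (fun x => F x.1 x.2)).
Qed.

(* With matrices: [p (A v + C w) - (p A + l B + g) v = - g v - h w], since
   [p C = - l D - h] and [B v + D w = 0]. *)
Lemma adjoint_cancellation (R : comPzRingType) (n m k : nat)
    (p g v : 'I_n -> R) (h w : 'I_m -> R) (l : 'I_k -> R)
    (A : 'I_n -> 'I_n -> R) (C : 'I_n -> 'I_m -> R)
    (B : 'I_k -> 'I_n -> R) (D : 'I_k -> 'I_m -> R) :
  (forall j, 0 = \sum_i p i * C i j + \sum_a l a * D a j + h j) ->
  (forall a, 0 = \sum_j v j * B a j + \sum_j w j * D a j) ->
  \sum_i (p i * (\sum_j v j * A i j + \sum_j w j * C i j)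
          + v i * (- (\sum_j p j * A j i) - (\sum_a l a * B a i) - g i))
  = - (\sum_i g i * v i) - \sum_j h j * w j.
Proof.
(* Transposition: a bilinear form may be summed in either order. *)
have swap (r s : nat) (x : 'I_r -> R) (y : 'I_s -> R) E :
    \sum_i x i * (\sum_j y j * E i j) = \sum_j y j * (\sum_i x i * E i j).
  under eq_bigr do rewrite mulr_sumr.
  under [RHS]eq_bigr do rewrite mulr_sumr.
  rewrite exchange_big; apply: eq_bigr => j _; apply: eq_bigr => i _.
  by rewrite mulrCA.
move=> hu hphi.
have hC j : \sum_i p i * C i j = - (\sum_a l a * D a j) - h j.
  by apply/eqP; rewrite -opprD -addr_eq0 addrA -hu.
have hB a : \sum_j v j * B a j = - (\sum_j w j * D a j).
  by apply/eqP; rewrite -addr_eq0 -hphi.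
under eq_bigr do rewrite mulrDr !mulrBr mulrN.
rewrite !big_split/= !sumrN (swap _ _ p v) (swap _ _ p w) (swap _ _ v l).
under [X in _ + X + _]eq_bigr do rewrite hC mulrBr mulrN.
under [X in _ - X - _]eq_bigr do rewrite hB mulrN.
rewrite big_split/= !sumrN opprK (swap _ _ l w).
under [X in _ = - X - _]eq_bigr do rewrite mulrC.
under [X in _ = _ - X]eq_bigr do rewrite mulrC.
ring.
Qed.

Theorem proposition2p12 (R : realType) (n m k : nat)
    (Md : manifold R n) (Ma : manifold R m) (Phi : vector_bundle Md Ma k)
    (f : forall (x : Md) (y : Ma), tangent x)
    (phi : forall (x : Md) (y : Ma), Phi x y)
    (L : Md -> Ma -> R)
    (f_smooth : smooth_f f) (phi_smooth : smooth_phi phi)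
    (phi_rank : constant_rank phi) (L_smooth : smooth_L L)
    (I : set R) (I_open : open I) (I_interval : is_interval I)
    (q : R -> Md) (u : R -> Ma)
    (p : forall t, cotangent (q t))
    (lambda : forall t, {scalar Phi (q t) (u t)})
    (dq : forall t, tangent (q t)) (du : forall t, tangent (u t)) :
  adjoint_solution f phi L I p lambda ->
  variational_solution f phi I dq du ->
  forall t, I t ->
    is_derive t 1 (fun s => pairing (p s) (dq s) : R)
      (- grad_q L (u t) (dq t) - grad_u L (q t) (du t)).
Proof.
move=> adj var t It.
have [c ct] := triv_dom_cover Phi (q t, u t).
(* [grad_q] and [grad_u] at time [t] are read in these same charts, so the right-hand side needs no
   change of chart. *)
pose a := chart_at (q t); pose b := chart_at (u t).
have at_ : source (charts a) (q t) := chart_at_source (q t).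
have bt : source (charts b) (u t) := chart_at_source (u t).
(* [pairing] reads components in the chart [chart_at (q s)], which varies
   with [s]; near [t] it may be replaced by the fixed chart [a]. *)
apply: (near_eq_is_derive (f := fun s =>
    \sum_i ccomp (p s) a 0 i * tcomp (dq s) a 0 i)).
  near=> s; apply/esym/pairing_chart; near: s.
  (* By continuity, [q s] stays in the open source of [a] for [s] near [t]. *)
  have [qc _] := base_q_smooth (adjoint_base adj).
  by apply: qc => //; apply: open_nbhs_nbhs; split => //; exact: open_source.
set z := to_coord (charts a) (q t); set w := to_coord (charts b) (u t).
have zw A : A (q t, u t) -> coord_dom A a b (z, w).
  by split; rewrite ?to_coordK//; exact: to_coord_target.
have df : differentiable (fun x => loc_f f a b x.1 x.2) (z, w).
  by apply: smooth_differentiable (f_smooth a b) _; exact: zw.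
have dphi : differentiable (fun x => loc_phi phi c a b x.1 x.2) (z, w).
  by apply: smooth_differentiable (phi_smooth c a b) _; exact: zw.
have dp i := adjoint_ode adj i It at_ bt ct.
have ddq i := is_derive_rV_entry _ _ _ _ _ _ _ i (variational_ode var It at_ bt).
have dpdq i := is_deriveM (dp i) (ddq i).
have := is_derive_sum dpdq.
rewrite fct_sumE => dsum; apply: is_derive_eq dsum _.
rewrite /grad_q /grad_u -/a -/b -/z -/w.
under eq_bigr do rewrite !mxE (Dq_entry _ _ _ _ _ _ _ _ _ df) (Du_entry _ _ _ _ _ _ _ _ _ df).
(* Here [A], [C] are the partial Jacobians of f, [B], [D] those of phi, and [g], [h] the partial
   derivatives of L. *)
apply: adjoint_cancellation => j.
  exact: (adjoint_constraint adj j It at_ bt ct).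
rewrite -(Dq_entry _ _ _ _ _ _ _ _ _ dphi) -(Du_entry _ _ _ _ _ _ _ _ _ dphi).
have /(congr1 (fun x : 'rV_k => x 0 j)) := variational_constraint var It at_ bt ct.
by rewrite !mxE.
Unshelve. all: by end_near.
Qed.
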